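(* Let $\delta > 0$. Let $\mathcal{P}$ be the convex set of all cumulative distribution functions $F$ of non-negative real random variables satisfying $\int_0^\infty x \, dF(x) \leq 1$. For $F_X \in \mathcal{P}$, the cumulative distribution function of a non-negative random variable $X$, put $\Phi(F_X) := \mathbb{P}(X \geq 1+\delta)$. Then the function $\Phi : \mathcal{P} \to [0,1]$ attains its maximum over $\mathcal{P}$ at an extreme point of $\mathcal{P}$; consequently, $\mathbb{P}(X < 1+\delta)$, regarded as a function of $F_X \in \mathcal{P}$, attains its minimum over $\mathcal{P}$ at an extreme point of $\mathcal{P}$.
   Context: Cumulative distribution functions of non-negative random variables are identified with Borel probability measures on $[0,\infty)$, and convex combinations are taken accordingly. An extreme point of the convex set $\mathcal{P}$ is an element $F \in \mathcal{P}$ that cannot be written as $\lambda G + (1-\lambda) H$ with $0 < \lambda < 1$ and distinct $G, H \in \mathcal{P}$. The extreme points of $\mathcal{P}$ are of the form $F = p\,\delta_\alpha + (1-p)\,\delta_\beta$ with $\alpha, \beta \geq 0$, $p \in [0,1]$ and $\alpha p + \beta(1-p) \leq 1$, where $\delta_\alpha$ denotes the Dirac measure at $\alpha$ (this includes single Dirac measures). *)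

(* Defs.v *)
From HB Require Import structures.
From mathcomp Require Import all_boot all_order all_algebra.
From mathcomp Require Import all_classical all_reals all_analysis.
From mathcomp Require Import measurable_realfun.

Set Implicit Arguments.
Unset Strict Implicit.
Unset Printing Implicit Defensive.

Import Order.TTheory GRing.Theory Num.Theory.
Import numFieldNormedType.Exports.

Local Open Scope classical_set_scope.
Local Open Scope ring_scope.

Definition extreme_point (R : numDomainType) (E : lmodType R) (A : set E)
    (x : E) : Prop :=
  A x /\ ~ exists (t : R) (y z : E),
    [/\ 0 < t < 1, A y, A z, y <> z & x = t *: y + (1 - t) *: z].

(* A cdf is a [cumulativeBounded 0 1] function; for such an [F], the measure
   [dF] is [lebesgue_stieltjes_measure F], a probability on the Borel sets. *)
Definition nonneg_cdf (R : realType) (F : R -> R) : Prop :=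
  exists (d : measure_display) (T : measurableType d) (P : probability T R)
         (X : {RV P >-> R}),
    (forall w, 0 <= X w) /\ (forall r, cdf X r = (F r)%:E).

(* Viewed inside the vector space of functions, where convex combinations are
   pointwise and equality of cdfs is equality of functions. *)
Definition mean_le1_cdfs (R : realType) : set (R -> R^o) :=
  [set (F : R -> R^o) | F in [set F : cumulativeBounded (0 : R) (1 : R) |
    nonneg_cdf F /\
    (\int[lebesgue_stieltjes_measure F]_(x in `[0%R, +oo[) x%:E <= 1)%E]].
Arguments mean_le1_cdfs R : clear implicits.

Definition prob_ge (R : realType) (delta : R)
    (F : cumulativeBounded (0 : R) (1 : R)) : \bar R :=
  lebesgue_stieltjes_measure F `[1 + delta, +oo[.

Definition prob_lt (R : realType) (delta : R)
    (F : cumulativeBounded (0 : R) (1 : R)) : \bar R :=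
  lebesgue_stieltjes_measure F `]-oo, 1 + delta[.

Lemma lebesgue_stieltjes_eq (R : realType)
    (F : cumulativeBounded (0 : R) (1 : R))
    (mu : {measure set (measurableTypeR R) -> \bar R}) :
  (forall r : R, mu `]-oo, r]%classic = (F r)%:E) ->
  forall A, measurable A -> lebesgue_stieltjes_measure F A = mu A.
Proof.
move=> muF; apply: lebesgue_stieltjes_measure_unique => I [[a b]]/= _ <-.
rewrite /lebesgue_stieltjes_measure /measure_extension/=.
rewrite measurable_mu_extE/=; last exact: is_ocitv.
have [ab | ba] := leP a b; last first.
  by rewrite set_itv_ge ?wlength0 ?measure0// bnd_simp -leNgt ltW.
rewrite wlength_itv_bnd// EFinB -!muF.
have : `]a, b]%classic = `]-oo, b] `\` `]-oo, a] => [|->].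
  by rewrite -[RHS]setCK setCD setCitvl setUC -[LHS]setCK setCitv.
rewrite measureD//=; last by rewrite muF ltry.
by rewrite setIidr//; exact: subset_itvl.
Qed.

Lemma lebesgue_stieltjes_distribution (R : realType)
    (F : cumulativeBounded (0 : R) (1 : R)) (d : measure_display)
    (T : measurableType d) (P : probability T R) (X : {RV P >-> R}) :
  (forall r, cdf X r = (F r)%:E) ->
  forall A : set R, measurable A ->
    lebesgue_stieltjes_measure F A = distribution P X A.
Proof.
move=> FX A mA.
pose Xm : T -> measurableTypeR R := X.
have mX : measurable_fun [set: T] Xm by exact: (@measurable_funPT _ _ _ _ X).
pose Xb : {mfun T >-> measurableTypeR R} :=
  HB.pack Xm (isMeasurableFun.Build _ _ _ _ Xm mX).
exact: (@lebesgue_stieltjes_eq R F (distribution P Xb)).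
Qed.

Lemma prob_geE (R : realType) (delta : R)
    (F : cumulativeBounded (0 : R) (1 : R)) (d : measure_display)
    (T : measurableType d) (P : probability T R) (X : {RV P >-> R}) :
  (forall r, cdf X r = (F r)%:E) ->
  prob_ge delta F = P [set w | 1 + delta <= X w].
Proof.
move=> FX; rewrite /prob_ge (lebesgue_stieltjes_distribution FX)//.
by congr (P _); apply/seteqP; split=> w /=; rewrite in_itv/= andbT.
Qed.

Lemma prob_ltE (R : realType) (delta : R)
    (F : cumulativeBounded (0 : R) (1 : R)) (d : measure_display)
    (T : measurableType d) (P : probability T R) (X : {RV P >-> R}) :
  (forall r, cdf X r = (F r)%:E) ->
  prob_lt delta F = P [set w | X w < 1 + delta].
Proof.
move=> FX; rewrite /prob_lt (lebesgue_stieltjes_distribution FX)//.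
Qed.

Lemma prob_ge_itv01 (R : realType) (delta : R)
    (F : cumulativeBounded (0 : R) (1 : R)) :
  (0 <= prob_ge delta F <= 1)%E.
Proof.
by rewrite measure_ge0/=; exact: probability_le1.
Qed.

Lemma nonneg_cdfP (R : realType) (F : cumulativeBounded (0 : R) (1 : R)) :
  nonneg_cdf F <-> forall r, r < 0 -> F r = 0.
Proof.
split=> [[d [T [P [X [X0 FX]]]]] r r0|F0].
  apply: EFin_inj; rewrite -FX /cdf /distribution /pushforward.
  rewrite (_ : _ @^-1` _ = set0) ?measure0//.
  apply/seteqP; split=> w //=; rewrite in_itv/= => Xr.
  by have := le_lt_trans (le_trans (X0 w) Xr) r0; rewrite ltxx.
pose m : probability (measurableTypeR R) R := lebesgue_stieltjes_measure F.
pose Y : measurableTypeR R -> R := fun x => Num.max 0 x.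
have mY : measurable_fun [set: measurableTypeR R] Y.
  by apply: (@measurable_maxr _ (measurableTypeR R)) => //.
pose X : {RV m >-> R} := HB.pack Y (isMeasurableFun.Build _ _ _ _ Y mY).
exists _, (measurableTypeR R), m, X; split=> [w|r].
  by rewrite /= /Y le_max lexx.
rewrite -cdf_lebesgue_stieltjes_id /cdf /distribution /pushforward.
have [r0|r0] := ltP r 0.
  rewrite [RHS](_ : _ = (F r)%:E); last exact: cdf_lebesgue_stieltjes_id.
  rewrite F0// (_ : _ @^-1` _ = set0) ?measure0//.
  by apply/seteqP; split=> w //=; rewrite in_itv/= /Y ge_max leNgt r0.
congr (m _); apply/seteqP; split=> w /=; rewrite !in_itv/= /Y ge_max r0//.
Qed.

Lemma convex_mean_le1_cdfs (R : realType) :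
  @convex_set R (R -> R^o) (mean_le1_cdfs R).
Proof.
apply/convex_setW => x y; rewrite !inE => -[F [F0 F1] <-] [G [G0 G1] <-] t t0 t1.
set s := t%:num.
have s1 : 0 <= 1 - s by rewrite subr_ge0 ltW.
pose h : R -> R := fun r => s * F r + (1 - s) * G r.
have hnd : nondecreasing h.
  move=> a b ab; rewrite /h lerD// ler_wpM2l ?(ltW t0)//.
  - exact: (cumulative_is_nondecreasing F).
  - exact: (cumulative_is_nondecreasing G).
have hrc : right_continuous h.
  move=> a; apply: cvgD; apply: cvgMl_tmp.
  - exact: (cumulative_is_right_continuous F).
  - exact: (cumulative_is_right_continuous G).
have hN : h @ -oo --> (0 : R).
  rewrite (_ : 0 = s * 0 + (1 - s) * 0); last by rewrite !mulr0 addr0.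
  by apply: cvgD; apply: cvgMl_tmp; exact: cumulativeNy.
have hy : h @ +oo --> (1 : R).
  rewrite (_ : 1 = s * 1 + (1 - s) * 1); last by rewrite !mulr1 addrC subrK.
  by apply: cvgD; apply: cvgMl_tmp; exact: cumulativey.
pose H : cumulativeBounded (0 : R) (1 : R) :=
  HB.pack h (isCumulative.Build R _ R h hnd hrc)
            (isCumulativeBounded.Build R 0 1 h hN hy).
rewrite inE; exists H; last by [].
split.
  apply/nonneg_cdfP => r r0 /=; rewrite /h.
  move/nonneg_cdfP : F0 => ->//; move/nonneg_cdfP : G0 => ->//.
  by rewrite !mulr0 addr0.
pose mF : {measure set (measurableTypeR R) -> \bar R} :=
  lebesgue_stieltjes_measure F.
pose mG : {measure set (measurableTypeR R) -> \bar R} :=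
  lebesgue_stieltjes_measure G.
pose a : {nonneg R} := NngNum (ltW t0).
pose b : {nonneg R} := NngNum s1.
pose mu : {measure set (measurableTypeR R) -> \bar R} :=
  measure_add (mscale a mF) (mscale b mG).
have muH A : measurable A -> lebesgue_stieltjes_measure H A = mu A.
  apply: lebesgue_stieltjes_eq => r.
  rewrite [LHS](measure_addE (mscale a mF) (mscale b mG)) /mscale/=.
  have lsE (K : cumulativeBounded (0 : R) (1 : R)) :
      lebesgue_stieltjes_measure K `]-oo, r]%classic = (K r)%:E.
    exact: cdf_lebesgue_stieltjes_id.
  rewrite [X in (_ * X + _)%E](lsE F) [X in (_ + _ * X)%E](lsE G).
  by rewrite -!EFinM -EFinD.
have mI : measurable (`[0, +oo[%classic : set (measurableTypeR R)).
  exact: (@measurable_itv R).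
have mid : measurable_fun (`[0, +oo[%classic : set (measurableTypeR R)) (@EFin R).
  apply: (@measurable_funTS _ _ (measurableTypeR R)).
  exact/measurable_EFinP/measurable_id.
have id0 (z : measurableTypeR R) : `[0, +oo[%classic z -> (0 <= (z : R)%:E)%E.
  by rewrite /= in_itv/= andbT lee_fin.
rewrite (eq_measure_integral mu); last by move=> A mA _; exact: muH.
rewrite ge0_integral_measure_add// !ge0_integral_mscale//=.
apply: (@le_trans _ _ (s%:E * 1 + (1 - s)%:E * 1)%E).
  by apply: leeD; apply: lee_wpmul2l; rewrite ?lee_fin ?(ltW t0).
by rewrite !mule1 -EFinD addrC subrK.
Qed.

(* Main.v *)
Require Import Defs.
From HB Require Import structures.
From mathcomp Require Import all_boot all_order all_algebra.
From mathcomp Require Import all_classical all_reals all_analysis.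
From mathcomp Require Import ring lra measurable_realfun.
Import Order.TTheory GRing.Theory Num.Theory.
Import numFieldNormedType.Exports.
Local Open Scope classical_set_scope.
Local Open Scope ring_scope.

(** Put [c = 1 + delta].  Markov's inequality ([markov_cdf]) bounds
    [P(X >= c)] by [1 / c] over all laws on [[0, +oo[] of mean at most [1].
    The two-point law [(1 - 1/c) d_0 + (1/c) d_c] has mean exactly [1]
    ([two_point_mean_le1]) and puts mass [1 / c] on [[c, +oo[], so it is a
    maximizer.

    It is also an extreme point ([two_point_extreme]).  Suppose its cdf [F] is
    a proper convex combination of cdfs [G] and [H] of the set.  Then [G] and
    [H] agree with [F] on [[c, +oo[], where [F] takes the largest possible
    value [1], and they are constant on [[0, c[], since there the combination
    of the two nondecreasing functions is constant.  Markov's inequality at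
    points close to [c] shows that these constants are at least [1 - 1/c],
    which is the value of [F]; as the combination equals [1 - 1/c], so does
    each of them.

    The statement on [P(X < c)] follows by taking complements, with the same
    law. *)

(** * Cumulative distribution functions and their measures *)

Lemma lebesgue_stieltjes_itvNyc {R : realType}
    (F : cumulativeBounded (0 : R) (1 : R)) (r : R) :
  lebesgue_stieltjes_measure F `]-oo, r] = (F r)%:E.
Proof. exact: cdf_lebesgue_stieltjes_id. Qed.

Lemma cumulative01_le1 {R : realType}
    (F : cumulativeBounded (0 : R) (1 : R)) (r : R) : F r <= 1.
Proof.
by rewrite -lee_fin -lebesgue_stieltjes_itvNyc; exact: probability_le1.
Qed.

(* Stieltjes measures live on [measurableTypeR R], a copy of [R]. *)
Lemma measurable_EFin_nneg (R : realType) :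
  measurable_fun (`[0, +oo[%classic : set (measurableTypeR R)) (@EFin R).
Proof.
apply: (@measurable_funTS _ _ (measurableTypeR R)).
exact/measurable_EFinP/measurable_id.
Qed.

Lemma prob_lt_ge {R : realType} (delta : R)
    (F : cumulativeBounded (0 : R) (1 : R)) :
  prob_lt delta F = (1 - prob_ge delta F)%E.
Proof.
rewrite /prob_lt /prob_ge -setCitvr.
by rewrite (@probability_setC _ (measurableTypeR R)).
Qed.

(** Markov's inequality for a law of mean at most [1]; only the part of the
    mean carried by [[0, +oo[] matters. *)
Lemma markov_cdf {R : realType} {F : cumulativeBounded (0 : R) (1 : R)}
    {a : R} :
  0 < a -> (\int[lebesgue_stieltjes_measure F]_(x in `[0%R, +oo[) x%:E <= 1)%E ->
  (lebesgue_stieltjes_measure F `[a, +oo[ <= (a^-1)%:E)%E.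
Proof.
move=> a0 F1.
have mI : measurable (`[0, +oo[%classic : set (measurableTypeR R)).
  exact: (@measurable_itv R).
have mid := measurable_EFin_nneg R.
have abs1 :
    (\int[lebesgue_stieltjes_measure F]_(x in `[0%R, +oo[) `|x%:E| <= 1)%E.
  rewrite (@eq_integral _ (measurableTypeR R) _ _ _ (@EFin R))// => x.
  by rewrite inE/= in_itv/= andbT => x0; rewrite ger0_norm.
have := le_trans
  (le_integral_abse (lebesgue_stieltjes_measure F) mI mid a0) abs1.
rewrite (_ : _ `&` _ = `[a, +oo[%classic); last first.
  apply/seteqP; split=> x /=; rewrite !in_itv/= !andbT lee_fin.
    by case=> x0; rewrite ger0_norm.
  by move=> ax; have x0 := le_trans (ltW a0) ax; rewrite ger0_norm.
rewrite muleC -lee_pdivlMr//.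
by rewrite mul1e.
Qed.

Lemma markov_cdf_le {R : realType} {F : cumulativeBounded (0 : R) (1 : R)}
    {r : R} :
  0 < r -> (\int[lebesgue_stieltjes_measure F]_(x in `[0%R, +oo[) x%:E <= 1)%E ->
  1 - r^-1 <= F r.
Proof.
move=> r0 F1; rewrite lerBlDr -lerBlDl -lee_fin.
apply: le_trans (markov_cdf r0 F1).
rewrite EFinB -lebesgue_stieltjes_itvNyc.
rewrite -(@probability_setC _ (measurableTypeR R))// setCitvl.
by apply: le_measure; rewrite ?inE//; apply: subset_itvr; rewrite bnd_simp.
Qed.

(** * Two-point laws *)

(** The cdf of the Dirac measure at [a]. *)
Definition step {R : realType} (a r : R) : R := (a <= r)%R%:R.

Lemma step_nondecreasing {R : realType} (a : R) : nondecreasing (step a).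
Proof.
move=> x y xy; rewrite /step ler_nat; case: (leP a x) => // ax.
by rewrite (le_trans ax xy).
Qed.

Lemma step_right_continuous {R : realType} (a : R) : right_continuous (step a).
Proof.
move=> x; apply: cvg_near_cst; rewrite /step; have [ax|xa] := leP a x.
  near=> y; have -> //: a <= y.
  by apply: le_trans ax _; apply: ltW; near: y; exact: nbhs_right_gt.
near=> y; rewrite leNgt.
by have -> : y < a by near: y; exact: nbhs_right_lt.
Unshelve. all: by end_near. Qed.

Lemma cvgy_step {R : realType} (a : R) : step a @ +oo --> (1 : R).
Proof.
apply: cvg_near_cst; near=> y; rewrite /step.
by have -> : a <= y by near: y; apply: nbhs_pinfty_ge; exact: num_real.
Unshelve. all: by end_near. Qed.

Lemma cvgNy_step {R : realType} (a : R) : step a @ -oo --> (0 : R).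
Proof.
apply: cvg_near_cst; near=> y; rewrite /step leNgt.
by have -> : y < a by near: y; apply: nbhs_ninfty_lt; exact: num_real.
Unshelve. all: by end_near. Qed.

(** The cdf of the law [(1 - p) d_a + p d_b], for [p] between [0] and [1]. *)
Definition two_point {R : realType} (p a b r : R) : R :=
  (1 - p) * step a r + p * step b r.

Lemma two_point_cumulative {R : realType} (p a b : R) : 0 <= p <= 1 ->
  exists F : cumulativeBounded (0 : R) (1 : R), F = two_point p a b :> (R -> R).
Proof.
move=> /andP[p0 p1].
have hnd : nondecreasing (two_point p a b).
  move=> x y xy; rewrite lerD// ler_wpM2l ?subr_ge0//;
    exact: step_nondecreasing.
have hrc : right_continuous (two_point p a b).
  by move=> x; apply: cvgD; apply: cvgMl_tmp; exact: step_right_continuous.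
have hN : two_point p a b @ -oo --> (0 : R).
  rewrite (_ : 0 = (1 - p) * 0 + p * 0); last by rewrite !mulr0 addr0.
  by apply: cvgD; apply: cvgMl_tmp; exact: cvgNy_step.
have hy : two_point p a b @ +oo --> (1 : R).
  rewrite (_ : 1 = (1 - p) * 1 + p * 1); last by rewrite !mulr1 subrK.
  by apply: cvgD; apply: cvgMl_tmp; exact: cvgy_step.
pose F : cumulativeBounded (0 : R) (1 : R) :=
  HB.pack (two_point p a b) (isCumulative.Build R _ R _ hnd hrc)
          (isCumulativeBounded.Build R 0 1 _ hN hy).
by exists F.
Qed.

Lemma two_point_measure {R : realType} {p a b : R} (p0 : 0 <= p)
    (q0 : 0 <= 1 - p) {F : cumulativeBounded (0 : R) (1 : R)} :
  F = two_point p a b :> (R -> R) ->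
  forall A : set (measurableTypeR R), measurable A ->
  lebesgue_stieltjes_measure F A =
  measure_add (mscale (NngNum q0) (\d_(a : measurableTypeR R)))
              (mscale (NngNum p0) (\d_(b : measurableTypeR R))) A.
Proof.
move=> FE; apply: lebesgue_stieltjes_eq => r.
rewrite [LHS](measure_addE (mscale _ _) (mscale _ _)) /= /mscale /= !diracE.
rewrite FE /two_point /step [in RHS]EFinD !EFinM.
by rewrite !mem_setE !in_itv.
Qed.

Lemma two_point_prob_ge {R : realType} {p delta : R}
    {F : cumulativeBounded (0 : R) (1 : R)} :
  0 <= p <= 1 -> 0 < 1 + delta -> F = two_point p 0 (1 + delta) :> (R -> R) ->
  prob_ge delta F = p%:E.
Proof.
move=> /andP[p0 p1] c0 FE; have q0 : 0 <= 1 - p by rewrite subr_ge0.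
rewrite /prob_ge (two_point_measure p0 q0 FE)//.
rewrite [LHS](measure_addE (mscale _ _) (mscale _ _)) /= /mscale /=.
rewrite !diracE !mem_setE !in_itv/= !andbT lexx leNgt c0.
by rewrite mule0 add0e mule1.
Qed.

Lemma two_point_mean_le1 {R : realType} {c : R}
    {F : cumulativeBounded (0 : R) (1 : R)} :
  1 <= c -> F = two_point c^-1 0 c :> (R -> R) -> mean_le1_cdfs R F.
Proof.
move=> c1 FE; have c0 : 0 < c by apply: lt_le_trans c1.
have p0 : 0 <= c^-1 by rewrite invr_ge0 ltW.
have q0 : 0 <= 1 - c^-1 by rewrite subr_ge0 invf_le1.
exists F => //; split.
  apply/nonneg_cdfP => r r0; rewrite FE /two_point /step.
  by rewrite !leNgt r0 (lt_trans r0 c0) !mulr0 addr0.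
have mI : measurable (`[0, +oo[%classic : set (measurableTypeR R)).
  exact: (@measurable_itv R).
have mid := measurable_EFin_nneg R.
have id0 (z : measurableTypeR R) : `[0, +oo[%classic z -> (0 <= (z : R)%:E)%E.
  by rewrite /= in_itv/= andbT lee_fin.
rewrite (eq_measure_integral _ (fun A mA _ => two_point_measure p0 q0 FE A mA)).
rewrite ge0_integral_measure_add// !ge0_integral_mscale//= !integral_dirac//.
rewrite !diracE !mem_setE !in_itv/= lexx (ltW c0)/= !mul1e mule0 add0e -EFinM.
by rewrite mulVf// gt_eqF.
Qed.

(** * Extremality *)

(** If two componentwise comparable pairs have the same proper convex
    combination, then they are equal. *)
Lemma convex_comb_eq {R : realType} {t x x' y y' : R} :
  0 < t < 1 -> x <= x' -> y <= y' ->
  t * x + (1 - t) * y = t * x' + (1 - t) * y' -> x = x' /\ y = y'.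
Proof.
move=> /andP[t0 t1] xx yy e; have s0 : 0 < 1 - t by rewrite subr_gt0.
by split; nra.
Qed.

(** When [F] is constant on [[0, c[], the value [F 0] is also the left limit of
    [F] at [c], so this is Markov's inequality at [c] for that left limit. *)
Lemma constant_cdf_ge {R : realType} {c : R}
    {F : cumulativeBounded (0 : R) (1 : R)} :
  0 < c -> (\int[lebesgue_stieltjes_measure F]_(x in `[0%R, +oo[) x%:E <= 1)%E ->
  (forall r, 0 <= r < c -> F r = F 0) -> 1 - c^-1 <= F 0.
Proof.
move=> c0 F1 Fcst; rewrite leNgt; apply/negP => F0c.
(* If [1 - F 0 > 1 / c], then [r = 1 / (1 - F 0)] lies below [c], and so does
   the midpoint of [r] and [c], where Markov's inequality fails. *)
have d0 : c^-1 < 1 - F 0 by lra.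
have e0 : 0 < 1 - F 0 by apply: lt_trans d0; rewrite invr_gt0.
have rc : (1 - F 0)^-1 < c by rewrite -[ltRHS]invrK ltf_pV2// posrE invr_gt0.
have r0 : 0 < (1 - F 0)^-1 by rewrite invr_gt0.
set m := ((1 - F 0)^-1 + c) / 2.
have mr : (1 - F 0)^-1 < m by rewrite /m; lra.
have mc : m < c by rewrite /m; lra.
have m0 : 0 < m by exact: lt_trans mr.
have := markov_cdf_le m0 F1; rewrite Fcst ?(ltW m0)// lerBlDr -lerBlDl.
by apply/negP; rewrite -ltNge -[ltRHS]invrK ltf_pV2// posrE.
Qed.

Lemma two_point_extreme {R : realType} {c : R}
    {F : cumulativeBounded (0 : R) (1 : R)} :
  1 <= c -> F = two_point c^-1 0 c :> (R -> R) ->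
  extreme_point (mean_le1_cdfs R) F.
Proof.
move=> c1 FE; have c0 : 0 < c by apply: lt_le_trans c1.
split; first exact: two_point_mean_le1 FE.
move=> [t [y [z [t01 [G [G0 G1] <-] [H [H0 H1] <-] GH]]]] FGH; apply: GH.
have E r : two_point c^-1 0 c r = t * G r + (1 - t) * H r.
  by rewrite -FE; exact: (congr1 (@^~ r) FGH).
have Gcst_Hcst r : 0 <= r < c -> G 0 = G r /\ H 0 = H r.
  move=> /andP[r0 rc]; apply: (convex_comb_eq t01).
  - exact: (cumulative_is_nondecreasing G).
  - exact: (cumulative_is_nondecreasing H).
  - by rewrite -!E /two_point /step lexx r0 !leNgt rc c0.
have Gge : 1 - c^-1 <= G 0.
  by apply: constant_cdf_ge => // r /Gcst_Hcst[].
have Hge : 1 - c^-1 <= H 0.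
  by apply: constant_cdf_ge => // r /Gcst_Hcst[].
have [GE HE] : 1 - c^-1 = G 0 /\ 1 - c^-1 = H 0.
  apply: (convex_comb_eq t01) => //.
  by rewrite -E /two_point /step lexx leNgt c0/=; ring.
apply/funext => r; have [r0|r0] := ltP r 0.
  by move/nonneg_cdfP : G0 => ->//; move/nonneg_cdfP : H0 => ->.
have [rc|cr] := ltP r c.
  have r0c : 0 <= r < c by rewrite r0 rc.
  by have [<- <-] := Gcst_Hcst r r0c; rewrite -GE.
have [-> ->//] : G r = 1 /\ H r = 1.
apply: (convex_comb_eq t01); rewrite ?cumulative01_le1// -E.
by rewrite /two_point /step r0 cr/=; ring.
Qed.

Theorem mainTheorem1 (R : realType) (delta : R) (delta_gt0 : 0 < delta) :
  (exists F : cumulativeBounded (0 : R) (1 : R),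
     extreme_point (mean_le1_cdfs R) F /\
     forall G : cumulativeBounded (0 : R) (1 : R),
       mean_le1_cdfs R G -> (prob_ge delta G <= prob_ge delta F)%E) /\
  (exists F : cumulativeBounded (0 : R) (1 : R),
     extreme_point (mean_le1_cdfs R) F /\
     forall G : cumulativeBounded (0 : R) (1 : R),
       mean_le1_cdfs R G -> (prob_lt delta F <= prob_lt delta G)%E).
Proof.
have c1 : 1 <= 1 + delta by rewrite lerDl ltW.
have c0 : 0 < 1 + delta by apply: lt_le_trans c1.
have p01 : 0 <= (1 + delta)^-1 <= 1 by rewrite invr_ge0 ltW//= invf_le1.
(* This [F] puts mass [1 / (1 + delta)] at [1 + delta], the rest at [0]. *)
have [F FE] := two_point_cumulative (1 + delta)^-1 0 (1 + delta) p01.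
have Fmax (G : cumulativeBounded (0 : R) (1 : R)) :
    mean_le1_cdfs R G -> (prob_ge delta G <= prob_ge delta F)%E.
  (* Membership of the function [G] yields a bundled cdf [K] with the same
     underlying function, hence the same measure. *)
  move=> [K [K0 K1] KG]; rewrite (two_point_prob_ge p01 c0 FE).
  have -> : prob_ge delta G = prob_ge delta K.
    apply: lebesgue_stieltjes_eq => // r.
    have -> : G r = K r by rewrite -KG.
    exact: lebesgue_stieltjes_itvNyc.
  exact: markov_cdf.
have Fext := two_point_extreme c1 FE.
split; exists F; split=> // G /Fmax GF.
by rewrite !prob_lt_ge leeB.
Qed.
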